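(* (Full observation.) Let $G_1$, $G_2$ and $G_k$ be generators over alphabets $\Sigma_1$, $\Sigma_2$ and $\Sigma_k$, respectively, where $\Sigma_1\cap\Sigma_2\subseteq\Sigma_k\subseteq\Sigma_1\cup\Sigma_2$. Let $K\subseteq L_m(G_1\parallel G_2\parallel G_k)$ be a language such that $K$ and $\overline{K}$ are conditionally decomposable with respect to $\Sigma_1,\Sigma_2,\Sigma_k$. Assume all events are observable. There exist nonblocking supervisors $S_1$ and $S_2$, where $S_i$ is a supervisor for the plant $G_i\parallel G_k$ with controllable events $\Sigma_{i+k,c}$, such that $L_m(S_i/[G_i\parallel G_k])\subseteq P_{i+k}(K)$ for $i=1,2$ and $$L_m(S_1/[G_1\parallel G_k])\parallel L_m(S_2/[G_2\parallel G_k])=K$$ if and only if $K$ is both conditionally controllable and conditionally closed for $G_1,G_2,G_k$.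
   Context: A generator is $G=(Q,\Sigma,f,q_0,Q_m)$ with finite state set $Q$, finite nonempty alphabet $\Sigma$, partial transition function $f:Q\times\Sigma\to Q$ (extended to words), initial state $q_0$ and marked states $Q_m\subseteq Q$; $L(G)=\{s\in\Sigma^*\mid f(q_0,s)\text{ is defined}\}$ and $L_m(G)=\{s\mid f(q_0,s)\in Q_m\}$. $\overline{L}$ denotes the prefix closure of $L$. A (natural) projection $\Sigma^*\to\Sigma_0^*$, $\Sigma_0\subseteq\Sigma$, erases the letters not in $\Sigma_0$. For $L_i\subseteq\Sigma_i^*$, $L_1\parallel L_2=P_1^{-1}(L_1)\cap P_2^{-1}(L_2)$, where $P_i:(\Sigma_1\cup\Sigma_2)^*\to\Sigma_i^*$ are the projections; for generators $\parallel$ is the synchronous product, satisfying $L(G_1\parallel G_2)=L(G_1)\parallel L(G_2)$ and $L_m(G_1\parallel G_2)=L_m(G_1)\parallel L_m(G_2)$. The global alphabet $\Sigma=\Sigma_1\cup\Sigma_2$ is partitioned into controllable events $\Sigma_c$ and uncontrollable events $\Sigma_u=\Sigma\setminus\Sigma_c$. Put $\Sigma_{i+k}=\Sigma_i\cup\Sigma_k$, $\Sigma_{i+k,c}=\Sigma_{i+k}\cap\Sigma_c$, $\Sigma_{i+k,u}=\Sigma_{i+k}\cap\Sigma_u$; $P_{i+k}:\Sigma^*\to\Sigma_{i+k}^*$ is the projection. Supervisors (full observation): for a generator $G$ over an alphabet $A$ with controllable events $A_c$ and uncontrollable events $A_u=A\setminus A_c$, a supervisor is a map $S:L(G)\to\Gamma=\{\gamma\subseteq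 A\mid A_u\subseteq\gamma\}$. The closed-loop language $L(S/G)$ is the smallest language such that $\varepsilon\in L(S/G)$ and, if $s\in L(S/G)$, $sa\in L(G)$ and $a\in S(s)$, then $sa\in L(S/G)$. Moreover $L_m(S/G)=L(S/G)\cap L_m(G)$, and $S$ is nonblocking if $\overline{L_m(S/G)}=L(S/G)$. A language $M$ is controllable with respect to $L(G)$ and $A_u$ if $\overline{M}A_u\cap L(G)\subseteq\overline{M}$; it is $L_m(G)$-closed if $M=\overline{M}\cap L_m(G)$. A language $M\subseteq\Sigma^*$ is conditionally decomposable with respect to $\Sigma_1,\Sigma_2,\Sigma_k$ if $M=P_{1+k}(M)\parallel P_{2+k}(M)$. A language $M\subseteq L_m(G_1\parallel G_2\parallel G_k)$ is: conditionally controllable for $G_1,G_2,G_k$ if, for $i=1,2$, $P_{i+k}(M)$ is controllable with respect to $L(G_i\parallel G_k)$ and $\Sigma_{i+k,u}$; conditionally closed for $G_1,G_2,G_k$ if $M$ is nonempty and, for $i=1,2$, $P_{i+k}(M)$ is $L_m(G_i\parallel G_k)$-closed. *)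

(* Defs.v *)
From mathcomp Require Import all_boot.
From mathcomp Require Import boolp classical_sets.

Set Implicit Arguments.
Unset Strict Implicit.
Unset Printing Implicit Defensive.

Local Open Scope classical_set_scope.

(* All alphabets are subsets of one ambient finite type E of
   events, so that words over different alphabets share the type seq E; a
   language over A is a set of words contained in words A. *)

Section Languages.
Variable E : finType.
Implicit Types (A B D : {set E}) (L M : set (seq E)) (s : seq E).

Definition words A : set (seq E) := [set s | {subset s <= A}].

Definition proj A s : seq E := [seq a <- s | a \in A].

(* Inverse image under the projection D^* -> A^*; the domain is part of the
   data, since proj A is defined on all words over E. *)
Definition inv_proj D A L : set (seq E) := words D `&` proj A @^-1` L.

Definition par A B L M : set (seq E) :=
  inv_proj (A :|: B) A L `&` inv_proj (A :|: B) B M.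

Definition pclosure L : set (seq E) := [set s | exists t, L (s ++ t)].

Definition controllable L (Au : {set E}) M : Prop :=
  forall s a, pclosure M s -> a \in Au -> L (rcons s a) ->
    pclosure M (rcons s a).

Definition cond_decomposable (S1 S2 Sk : {set E}) M : Prop :=
  M = par (S1 :|: Sk) (S2 :|: Sk)
        (proj (S1 :|: Sk) @` M) (proj (S2 :|: Sk) @` M).

End Languages.

(* The partial transition function Q x A -> Q is rendered as an option-valued
   function on Q x E that is undefined on letters outside A. *)
Record generator (E : finType) (A : {set E}) := Generator {
  state : finType;
  trans : state -> E -> option state;
  init : state;
  marked : {set state};
  alphabet_neq0 : (0 < #|A|)%N;
  trans_alphabet : forall q a, a \notin A -> trans q a = None
}.

Section Generators.
Variables (E : finType) (A : {set E}) (G : generator A).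

Fixpoint run (q : state G) (s : seq E) : option (state G) :=
  if s is a :: s' then obind (run^~ s') (trans q a) else Some q.

Definition gen_lang : set (seq E) := [set s | exists q, run (init G) s = Some q].

Definition marked_lang : set (seq E) :=
  [set s | exists2 q, run (init G) s = Some q & q \in marked G].

Definition Lm_closed (M : set (seq E)) : Prop :=
  M = pclosure M `&` marked_lang.

End Generators.

Section SynchronousProduct.
Variables (E : finType) (A B : {set E}) (G : generator A) (H : generator B).

Definition sync_trans (p : state G * state H) (a : E) :
    option (state G * state H) :=
  if a \in A then
    if a \in B then
      obind (fun q => omap (pair q) (trans p.2 a)) (trans p.1 a)
    else omap (fun q => (q, p.2)) (trans p.1 a)
  else omap (pair p.1) (trans p.2 a).

Fact sync_alphabet_neq0 : (0 < #|A :|: B|)%N.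
Proof. exact: leq_trans (alphabet_neq0 G) (subset_leq_card (finset.subsetUl A B)). Qed.

Fact sync_trans_alphabet p a : a \notin A :|: B -> sync_trans p a = None.
Proof.
rewrite inE negb_or /sync_trans => /andP[/negbTE-> aNB].
by rewrite trans_alphabet.
Qed.

Definition sync : generator (A :|: B) :=
  {| state := (state G * state H)%type;
     trans := sync_trans;
     init := (init G, init H);
     marked := finset.setX (marked G) (marked H);
     alphabet_neq0 := sync_alphabet_neq0;
     trans_alphabet := sync_trans_alphabet |}.

End SynchronousProduct.

Section SyncFacts.
Variables (E : finType) (A B : {set E}) (G : generator A) (H : generator B).

Lemma run_words (C : {set E}) (F : generator C) (q q' : state F) s :
  run q s = Some q' -> words C s.
Proof.
elim: s q => [|a s IH] q //=.
case E1: (trans q a) => [r|] //= /IH sC b; rewrite inE => /predU1P[->|/sC //].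
by apply: contraPT E1 => aC; rewrite trans_alphabet.
Qed.

Lemma run_sync (p : state (sync G H)) s : words (A :|: B) s ->
  run p s = obind (fun q => omap (pair q) (run p.2 (proj B s)))
                  (run p.1 (proj A s)).
Proof.
elim: s p => [|a s IH] [p1 p2] //= sAB.
have {}IH p := IH p (fun x xs => sAB x (@mem_behead _ (a :: s) _ xs)).
have := sAB a (mem_head _ _); rewrite inE /sync_trans /=.
case: (a \in A) => /=; case: (a \in B) => //= _.
- case: (trans p1 a) => [q1|] //=; case: (trans p2 a) => [q2|] /=.
    by rewrite (IH (q1, q2)).
  by case: (run q1 _).
- by case: (trans p1 a) => [q1|] //=; rewrite (IH (q1, p2)).
- case: (trans p2 a) => [q2|] /=; first by rewrite (IH (p1, q2)).
  by case: (run p1 _).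
Qed.

Lemma gen_lang_sync :
  gen_lang (sync G H) = par A B (gen_lang G) (gen_lang H).
Proof.
apply/seteqP; split => s.
- move=> [q qE]; have sAB := run_words qE; move: qE.
  rewrite run_sync //=; case E2: (run (init H) _) => [q2|]; case E1: (run (init G) _) => [q1|] //= _.
  by split; split => //; [exists q1 | exists q2].
- move=> [[sAB [q1 E1]] [_ [q2 E2]]].
  by exists (q1, q2); rewrite run_sync //= E1 /= E2.
Qed.

Lemma marked_lang_sync :
  marked_lang (sync G H) = par A B (marked_lang G) (marked_lang H).
Proof.
apply/seteqP; split => s.
- move=> [q qE]; have sAB := run_words qE; move: qE.
  rewrite run_sync //=; case E2: (run (init H) _) => [q2|]; case E1: (run (init G) _) => [q1|] //=.
  move=> [<-]; rewrite inE => /andP[/= m1 m2].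
  by split; split => //; [exists q1 | exists q2].
- move=> [[sAB [q1 E1 m1]] [_ [q2 E2 m2]]].
  by exists (q1, q2); [rewrite run_sync //= E1 /= E2 | rewrite inE m1].
Qed.

End SyncFacts.

(* A supervisor is a map on L(G); its values on words outside gen_lang G are
   arbitrary and never used by the closed loop. *)
Record supervisor (E : finType) (A : {set E}) (G : generator A)
    (Ac : {set E}) := Supervisor {
  sup_map :> seq E -> {set E};
  sup_mapP : forall s, gen_lang G s ->
    (sup_map s \subset A) /\ (A :\: Ac \subset sup_map s)
}.

Section ClosedLoop.
Variables (E : finType) (A : {set E}) (G : generator A) (Ac : {set E}).
Variable S : supervisor G Ac.

Inductive closed_loop : seq E -> Prop :=
| closed_loop_nil : closed_loop [::]
| closed_loop_rcons s a : closed_loop s -> gen_lang G (rcons s a) ->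
    a \in S s -> closed_loop (rcons s a).

Definition closed_loop_marked : set (seq E) := closed_loop `&` marked_lang G.

Definition nonblocking : Prop := pclosure closed_loop_marked = closed_loop.

End ClosedLoop.

Section Conditional.
Variables (E : finType) (S1 S2 Sk : {set E}).
Variables (G1 : generator S1) (G2 : generator S2) (Gk : generator Sk).

(* Su is the set of uncontrollable events of the global alphabet. *)
Definition cond_controllable (Su : {set E}) (M : set (seq E)) : Prop :=
  controllable (gen_lang (sync G1 Gk)) ((S1 :|: Sk) :&: Su)
    (proj (S1 :|: Sk) @` M) /\
  controllable (gen_lang (sync G2 Gk)) ((S2 :|: Sk) :&: Su)
    (proj (S2 :|: Sk) @` M).

Definition cond_closed (M : set (seq E)) : Prop :=
  [/\ M !=set0,
      Lm_closed (sync G1 Gk) (proj (S1 :|: Sk) @` M) &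
      Lm_closed (sync G2 Gk) (proj (S2 :|: Sk) @` M)].

End Conditional.

(* Main.v *)
(** For each plant, a language [M] is the marked language of a nonblocking
closed loop iff it is nonempty, controllable and [Lm_closed] (Ramadge and
Wonham); the supervisor enables the uncontrollable events and those that keep
the word in the prefix closure of [M].  Since [par] only keeps words whose
projections lie in its factors, the two inclusions and [par _ _ = K] force the
closed-loop marked languages to be exactly the projections of [K]. *)

Require Import Defs.
From mathcomp Require Import all_boot.
From mathcomp Require Import boolp classical_sets.

Set Implicit Arguments.
Unset Strict Implicit.
Unset Printing Implicit Defensive.

Local Open Scope classical_set_scope.

Lemma pclosure_rcons (E : finType) (M : set (seq E)) s a :
  pclosure M (rcons s a) -> pclosure M s.
Proof. by case=> t; rewrite cat_rcons; exists (a :: t). Qed.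

Section SupervisorSynthesis.
Variables (E : finType) (A : {set E}) (G : generator A).
Implicit Types (Ac : {set E}) (M : set (seq E)).

Lemma run_cat (q : state G) s t :
  run q (s ++ t) = obind (fun r => run r t) (run q s).
Proof. by elim: s q => //= a s IH q; case: (trans q a) => /=. Qed.

Lemma gen_lang_cat s t : gen_lang G (s ++ t) -> gen_lang G s.
Proof.
by case=> q; rewrite run_cat; case E1: (run _ s) => [r|] // _; exists r.
Qed.

Lemma pclosure_gen_lang M :
  M `<=` marked_lang G -> pclosure M `<=` gen_lang G.
Proof.
by move=> MG s [t /MG[q stq _]]; apply: (@gen_lang_cat s t); exists q.
Qed.

Section SupervisorOf.
Variables (Ac : {set E}) (M : set (seq E)).

(** [M] is an arbitrary language, so membership in its prefix closure is decided classically. *)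
Definition supervisor_map s : {set E} :=
  [set a in A | (a \notin Ac) || `[< pclosure M (rcons s a) >]]%SET.

Lemma supervisor_mapP s : gen_lang G s ->
  (supervisor_map s \subset A) /\ (A :\: Ac \subset supervisor_map s).
Proof.
by move=> _; split; apply/fintype.subsetP => a; rewrite !inE => /andP[-> // ->].
Qed.

Definition supervisor_of : supervisor G Ac := Supervisor supervisor_mapP.

(** Controllability of [M] keeps the loop inside [pclosure M] when an uncontrollable event occurs; a
    controllable one is enabled only if it stays there. *)
Lemma closed_loop_supervisor_of :
    M !=set0 -> M `<=` marked_lang G ->
    controllable (gen_lang G) (A :\: Ac) M ->
  closed_loop supervisor_of = pclosure M.
Proof.
move=> [w Mw] MG ctrlM; apply/seteqP; split=> s.
  elim=> [|{}s a _ Ms Lsa]; first by exists w.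
  rewrite inE => /andP[aA /orP[aNc|/asboolP //]].
  by apply: ctrlM Lsa; rewrite // inE aNc.
(* Induction from the right, since the closed loop grows at the end of the word. *)
elim/last_ind: s => [|s a IH] Msa; first exact: closed_loop_nil.
have Lsa := pclosure_gen_lang MG Msa.
apply: closed_loop_rcons => //; first exact/IH/pclosure_rcons/Msa.
rewrite inE asboolT // orbT andbT.
by case: Lsa => q /run_words; apply; rewrite mem_rcons mem_head.
Qed.

End SupervisorOf.

Theorem nonblocking_supervisor_ex Ac M :
  (exists2 T : supervisor G Ac, nonblocking T & closed_loop_marked T = M) <->
  [/\ M !=set0, controllable (gen_lang G) (A :\: Ac) M & Lm_closed G M].
Proof.
split=> [[T nbT <-]|[M0 ctrlM clM]].
  (* By nonblocking, the prefix closure is the loop itself, so closedness is the definition of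
     [closed_loop_marked]. *)
  split; last by rewrite /Lm_closed nbT.
    (* The empty word is in the loop, hence extends to a marked word. *)
    have [t Mt] : pclosure (closed_loop_marked T) [::].
      by rewrite nbT; exact: closed_loop_nil.
    by exists t.
  rewrite /controllable nbT => s a Ts aAu Lsa.
  apply: closed_loop_rcons => //.
  have Ls : gen_lang G s.
    by move: Lsa; rewrite -cats1 => /gen_lang_cat.
  by have [_ /fintype.subsetP] := sup_mapP T Ls; apply.
have MG : M `<=` marked_lang G by rewrite clM => s [].
have loopE := closed_loop_supervisor_of M0 MG ctrlM.
have markedE : closed_loop_marked (supervisor_of Ac M) = M.
  by rewrite /closed_loop_marked loopE -clM.
by exists (supervisor_of Ac M); rewrite // /nonblocking markedE loopE.
Qed.

End SupervisorSynthesis.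

Theorem corollary8 (E : finType) (S1 S2 Sk Sc : {set E})
    (hSk_ge : S1 :&: S2 \subset Sk) (hSk_le : Sk \subset S1 :|: S2)
    (hSc : Sc \subset S1 :|: S2)
    (G1 : generator S1) (G2 : generator S2) (Gk : generator Sk)
    (K : set (seq E))
    (hK : K `<=` marked_lang (sync (sync G1 G2) Gk))
    (hKdec : cond_decomposable S1 S2 Sk K)
    (hKpdec : cond_decomposable S1 S2 Sk (pclosure K)) :
  (exists (T1 : supervisor (sync G1 Gk) ((S1 :|: Sk) :&: Sc))
          (T2 : supervisor (sync G2 Gk) ((S2 :|: Sk) :&: Sc)),
     [/\ nonblocking T1 /\ nonblocking T2,
         closed_loop_marked T1 `<=` proj (S1 :|: Sk) @` K,
         closed_loop_marked T2 `<=` proj (S2 :|: Sk) @` K &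
         par (S1 :|: Sk) (S2 :|: Sk)
           (closed_loop_marked T1) (closed_loop_marked T2) = K])
  <->
  (cond_controllable G1 G2 Gk ((S1 :|: S2) :\: Sc) K /\
   cond_closed G1 G2 Gk K).
Proof.
(* Reconciles the two forms of the local uncontrollable events: global ones lying in [A], and the
   complement in [A] of the local controllable ones. *)
have uncE (A : {set E}) : A \subset S1 :|: S2 ->
    A :&: ((S1 :|: S2) :\: Sc) = A :\: (A :&: Sc) :> {set E}.
  by move=> /finset.setIidPl A12; rewrite finset.setIDA A12 finset.setDIr finset.setDv finset.set0U.
have unc1 := uncE (S1 :|: Sk)%SET.
have unc2 := uncE (S2 :|: Sk)%SET.
rewrite finset.subUset finset.subsetUl hSk_le in unc1.
rewrite finset.subUset finset.subsetUr hSk_le in unc2.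
rewrite /cond_controllable /cond_closed unc1 // unc2 //.
split=> [[T1 [T2 [[nb1 nb2] sub1 sub2 parE]]]|[[ctrl1 ctrl2] [K0 cl1 cl2]]].
  have M1E : closed_loop_marked T1 = proj (S1 :|: Sk) @` K.
    by apply/seteqP; split=> // _ [s + <-]; rewrite -parE => -[[]].
  have M2E : closed_loop_marked T2 = proj (S2 :|: Sk) @` K.
    by apply/seteqP; split=> // _ [s + <-]; rewrite -parE => -[_ []].
  have [[_ [s Ks _]] ctrl1 cl1] :=
    (nonblocking_supervisor_ex _ _ _).1 (ex_intro2 _ _ T1 nb1 M1E).
  have [_ ctrl2 cl2] :=
    (nonblocking_supervisor_ex _ _ _).1 (ex_intro2 _ _ T2 nb2 M2E).
  by split=> //; split=> //; exists s.
have projK0 B : proj B @` K !=set0.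
  by case: K0 => s Ks; exists (proj B s), s.
have [T1 nb1 M1E] :=
  (nonblocking_supervisor_ex _ _ _).2 (And3 (projK0 _) ctrl1 cl1).
have [T2 nb2 M2E] :=
  (nonblocking_supervisor_ex _ _ _).2 (And3 (projK0 _) ctrl2 cl2).
(* The remaining equation is the conditional decomposability [hKdec] of [K]. *)
by exists T1, T2; rewrite M1E M2E; split.
Qed.
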